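(* Let $t$ and $k$ be positive integers with $k\equiv 1 \pmod 2$, and let $G$ be a $t$-connected graph of even order $n\geq 5t+3$. If $$\rho(G)\geq \rho\big(K_t\vee(K_{n-2t-1}\cup (t+1)K_1)\big),$$ then $G$ has a perfect $k$-matching, unless $G\cong K_t\vee(K_{n-2t-1}\cup (t+1)K_1)$.
   Context: All graphs are finite, simple (no loops or multiple edges). For a graph $G$, $\rho(G)$ denotes the spectral radius of $G$, i.e. the largest eigenvalue of its adjacency matrix. $K_m$ is the complete graph on $m$ vertices; $G_1\cup G_2$ is the disjoint union of $G_1$ and $G_2$, $mH$ is the disjoint union of $m$ copies of $H$, and $G_1\vee G_2$ (the join) is obtained from $G_1\cup G_2$ by adding all edges between a vertex of $G_1$ and a vertex of $G_2$. For a vertex $v$, $E_G(v)$ is the set of edges incident with $v$. A $k$-matching of $G$ is a function $f:E(G)\to\{0,1,\ldots,k\}$ with $\sum_{e\in E_G(v)} f(e)\leq k$ for every vertex $v$; it is a perfect $k$-matching if $\sum_{e\in E_G(v)} f(e)=k$ for every vertex $v$. *)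

(* Defs.v *)
From HB Require Import structures.
From mathcomp Require Import all_boot all_order all_algebra.
From mathcomp Require Import boolp classical_sets reals.
From mathcomp Require Import spectral complex polyrcf.

Set Implicit Arguments.
Unset Strict Implicit.
Unset Printing Implicit Defensive.

Import Order.TTheory GRing.Theory Num.Theory.

Local Open Scope ring_scope.

Record sgraph := SGraph {
  vertex :> finType;
  adj : rel vertex;
  adj_sym : symmetric adj;
  adj_irrefl : irreflexive adj
}.

Definition sgraph_iso (G H : sgraph) : Prop :=
  exists2 f : G -> H, bijective f & forall x y, adj (f x) (f y) = adj x y.

Section Constructions.

Definition complete_adj (m : nat) : rel 'I_m := fun i j => i != j.

Lemma complete_adj_sym m : symmetric (@complete_adj m).
Proof. by move=> i j; rewrite /complete_adj eq_sym. Qed.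

Lemma complete_adj_irrefl m : irreflexive (@complete_adj m).
Proof. by move=> i; rewrite /complete_adj eqxx. Qed.

Definition complete_graph (m : nat) : sgraph :=
  SGraph (@complete_adj_sym m) (@complete_adj_irrefl m).

Variables G H : sgraph.

Definition dunion_adj : rel (G + H)%type := fun u v =>
  match u, v with
  | inl x, inl y => adj x y
  | inr x, inr y => adj x y
  | _, _ => false
  end.

Lemma dunion_adj_sym : symmetric dunion_adj.
Proof. by case=> x [] y //=; rewrite adj_sym. Qed.

Lemma dunion_adj_irrefl : irreflexive dunion_adj.
Proof. by case=> x /=; rewrite adj_irrefl. Qed.

Definition dunion : sgraph := SGraph dunion_adj_sym dunion_adj_irrefl.

Definition join_adj : rel (G + H)%type := fun u v =>
  match u, v with
  | inl x, inl y => adj x y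
  | inr x, inr y => adj x y
  | _, _ => true
  end.

Lemma join_adj_sym : symmetric join_adj.
Proof. by case=> x [] y //=; rewrite adj_sym. Qed.

Lemma join_adj_irrefl : irreflexive join_adj.
Proof. by case=> x /=; rewrite adj_irrefl. Qed.

Definition graph_join : sgraph := SGraph join_adj_sym join_adj_irrefl.

Variable m : nat.

Definition copies_adj : rel ('I_m * G)%type := fun u v =>
  (u.1 == v.1) && adj u.2 v.2.

Lemma copies_adj_sym : symmetric copies_adj.
Proof. by move=> u v; rewrite /copies_adj eq_sym adj_sym. Qed.

Lemma copies_adj_irrefl : irreflexive copies_adj.
Proof. by move=> u; rewrite /copies_adj adj_irrefl andbF. Qed.

Definition copies : sgraph := SGraph copies_adj_sym copies_adj_irrefl.

End Constructions.

(* K_t \/ (K_{n-2t-1} \cup (t+1) K_1); the subtraction is truncated, so this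
   is a graph of order n only when 2t+1 <= n. *)
Definition extremal_graph (n t : nat) : sgraph :=
  graph_join (complete_graph t)
    (dunion (complete_graph (n - 2 * t - 1)) (copies (complete_graph 1) t.+1)).

(* G - S is connected (vacuously so when S is everything). *)
Definition connected_off (G : sgraph) (S : {set G}) : Prop :=
  forall x y : G, x \notin S -> y \notin S ->
    connect [rel u v | [&& u \notin S, v \notin S & adj u v]] x y.

(* G has more than t vertices and stays connected after the deletion of any
   fewer than t of them (so that K_m is (m-1)-connected). *)
Definition vertex_connected (t : nat) (G : sgraph) : Prop :=
  (t < #|G|)%N /\ forall S : {set G}, (#|S| < t)%N -> connected_off S.

Definition edges (G : sgraph) : {set {set G}} :=
  [set A : {set G} | [exists x : G, exists y : G,
                        adj x y && (A == [set x; y]%SET)]].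

Definition edge (G : sgraph) := {A : {set G} | A \in edges G}.

Definition weight_at (G : sgraph) (k : nat) (f : edge G -> 'I_k.+1) (v : G) : nat :=
  (\sum_(e : edge G | v \in val e) f e)%N.

Definition k_matching (G : sgraph) (k : nat) (f : edge G -> 'I_k.+1) : Prop :=
  forall v : G, (weight_at f v <= k)%N.

Definition perfect_k_matching (G : sgraph) (k : nat) (f : edge G -> 'I_k.+1)
    : Prop :=
  k_matching f /\ forall v : G, weight_at f v = k.

Definition has_perfect_k_matching (G : sgraph) (k : nat) : Prop :=
  exists f : edge G -> 'I_k.+1, perfect_k_matching f.

Definition adjacency (R : pzSemiRingType) (G : sgraph) : 'M[R]_#|G| :=
  \matrix_(i, j) (adj (enum_val i) (enum_val j))%:R.

(* The supremum of the (finite) set of real eigenvalues; it is attained, see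
   spectral_radiusP. *)
Definition spectral_radius (R : realType) (G : sgraph) : R :=
  sup [set x : R | eigenvalue (adjacency R G) x]%classic.

Lemma adjacency_eigenvalue_ex (R : realType) (G : sgraph) :
  (0 < #|G|)%N -> exists x : R, eigenvalue (adjacency R G) x.
Proof.
move=> G0; pose C := complex R; pose A : 'M[C]_#|G| := adjacency C G.
have AE : A = map_mx (real_complex R) (adjacency R G).
  by apply/matrixP=> i j; rewrite !mxE rmorph_nat.
have Ah : A \is hermsymmx.
  apply/is_hermitianmxP; rewrite expr0 scale1r.
  by apply/matrixP=> i j; rewrite !mxE adj_sym conjC_nat.
have /mxOverP Dreal := hermitian_spectral_diag_real Ah.
pose i0 : 'I_#|G| := Ordinal G0.
set D := spectral_diag A in Dreal; pose z := D 0 i0.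
have Az : eigenvalue A z.
  have PA : spectralmx A *m A = diag_mx D *m spectralmx A.
    have /orthomx_spectralP {2}-> := hermitian_normalmx Ah.
    by rewrite !mulmxA mulmxV ?spectral_unit // mul1mx.
  apply/eigenvalueP; exists (row i0 (spectralmx A)).
    by rewrite -row_mul PA mul_diag_mx; apply/rowP=> j; rewrite !mxE.
  have : row_free (spectralmx A) by rewrite row_free_unit spectral_unit.
  move=> /row_freeP[B PB]; apply/eqP => r0.
  have /rowP/(_ i0) : row i0 (spectralmx A *m B) = 0 by rewrite row_mul r0 mul0mx.
  by rewrite PB !mxE eqxx => /eqP; rewrite oner_eq0.
have [x zx] : exists x, z = real_complex R x.
  by move: (Dreal 0 i0) => /complex_realP.
exists x; move: Az.
rewrite !eigenvalue_root_char AE -map_char_poly zx.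
by rewrite fmorph_root.
Qed.

Lemma spectral_radiusP (R : realType) (G : sgraph) : (0 < #|G|)%N ->
  eigenvalue (adjacency R G) (spectral_radius R G) /\
  forall x, eigenvalue (adjacency R G) x -> x <= spectral_radius R G.
Proof.
move=> G0; have [x0 x0A] := adjacency_eigenvalue_ex R G0.
pose s := rootsR (char_poly (adjacency R G)).
have sE x : eigenvalue (adjacency R G) x = (x \in s).
  rewrite eigenvalue_root_char.
  by rewrite -(roots_on_rootsR (monic_neq0 (char_poly_monic _))) in_itv.
pose m := \big[Order.max/x0]_(x <- s) x.
have ms x : x \in s -> x <= m by move=> xs; apply: le_bigmax_seq.
have mA : m \in s.
  rewrite /m big_seq; elim/big_ind: _ => [|x y xs ys|//]; first by rewrite -sE.
  by rewrite maxEle; case: ifP.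
suff -> : spectral_radius R G = m by split=> [|x]; rewrite sE //; apply: ms.
apply/eqP; rewrite eq_le; apply/andP; split.
  by apply: ge_sup => [|x /=]; [exists x0|rewrite sE; apply: ms].
by apply: ub_le_sup; [exists m => x /=|]; rewrite /= sE //; apply: ms.
Qed.

(* Main.v *)
Require Import Defs.
From mathcomp Require Import all_boot all_order all_algebra.
From mathcomp Require Import boolp reals.
From mathcomp Require Import zify ring lra.

Set Implicit Arguments.
Unset Strict Implicit.
Unset Printing Implicit Defensive.

(* A perfect matching taken [k] times is a perfect [k]-matching.  If there is no
   perfect matching, Tutte's theorem gives a set [S] of [s] vertices whose removal
   leaves at least [s + 2] classes without edges between them, and [s >= t] by
   connectivity.  Let [mu >= n - t - 2] be an eigenvalue of the extremal graph.
   The vector equal to [1] on [S] and to [s / (mu + 1 - m)] on a class of size [m]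
   is a positive supersolution [A y <= mu y] for [G]: by convexity the worst case
   is one class of size [n - 2 s - 1] and [s + 1] singletons, and for these the
   characteristic polynomial of the quotient matrix is positive at [mu] when
   [s > t] and zero when [s = t].  As [mu <= rho(G)], Perron's argument makes the
   supersolution tight, which forces [s = t] and identifies [G]. *)

(** * Matchings as involutions, and maximum matchings *)

Definition perfect_matching (V : finType) (e : rel V) (f : V -> V) : Prop :=
  involutive f /\ forall v, e v (f v).

(** Fixed points stand for unmatched vertices. Finite functions form a finite type, so a matching
    with fewest fixed points can be chosen. *)
Definition matching (V : finType) (e : rel V) (f : {ffun V -> V}) : bool :=
  [forall v, (f (f v) == v) && ((f v == v) || e v (f v))].

Definition unmatched (V : finType) (f : V -> V) : {set V} := [set v | f v == v].

Lemma matchingP (V : finType) (e : rel V) (f : {ffun V -> V}) :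
  reflect (involutive f /\ forall v, f v != v -> e v (f v)) (matching e f).
Proof.
apply: (iffP forallP) => [H|[fK fe] v].
  split=> v; have /andP[/eqP fK fe] := H v; first by [].
  by move=> fv; move: fe; rewrite (negPf fv).
by rewrite fK eqxx /=; case: eqVneq => //= /fe.
Qed.

(** Pairs [{x, f x}] with [f x != x] are removed from [A] until only fixed points remain. *)
Lemma odd_card_involution (V : finType) (f : V -> V) (A : {set V}) :
  involutive f -> (forall v, v \in A -> f v \in A) ->
  odd #|A| = odd #|A :&: unmatched f|.
Proof.
move=> fK; have [m] := ubnP #|A|; elim: m A => // m IH A leAm fA.
have [/forallP H|/forallPn[x]] := boolP [forall x in A, f x == x].
  congr (odd #|pred_of_set _|); apply/setP=> v; rewrite !inE.
  by have := H v; case: (v \in A) => //= ->.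
rewrite negb_imply => /andP[xA fx].
have xfx : f x \in A :\ x by rewrite !inE fx fA.
have eqA : #|A| = (#|A :\ x :\ f x|).+2.
  by rewrite (cardsD1 x A) xA (cardsD1 (f x) (A :\ x)) xfx.
rewrite eqA /= negbK IH; first last.
- move=> v; rewrite !inE => /and3P[v1 v2 vA]; rewrite fA // andbT.
  by rewrite (inj_eq (can_inj fK)) v2 -(inj_eq (can_inj fK)) fK v1.
- by move: leAm; rewrite eqA; lia.
congr (odd #|pred_of_set _|); apply/setP=> v; rewrite !inE.
case: eqVneq => [->|_] /=; first by rewrite fK [x == _]eq_sym (negPf fx) andbF.
by case: eqVneq => [->|_] //=; rewrite (negPf fx) andbF.
Qed.

(* Matches [a] to [b], leaving the former partner of [b] unmatched; [a] is
   meant to be unmatched in [f]. *)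
Definition rematch (V : finType) (f : {ffun V -> V}) (a b : V) : {ffun V -> V} :=
  [ffun v => if v == a then b else if v == b then a
             else if v == f b then v else f v].

Lemma rematch_matching (V : finType) (e : rel V) (f : {ffun V -> V}) (a b : V) :
  symmetric e -> irreflexive e -> matching e f -> f a = a -> e a b ->
  matching e (rematch f a b).
Proof.
move=> es ei /matchingP[fK fe] fa eab.
have ab : a != b by apply: contraTneq eab => ->; rewrite ei.
apply/matchingP; split=> v; rewrite !ffunE; last first.
  case: (eqVneq v a) => [->//|va]; case: (eqVneq v b) => [->|vb]; first by rewrite es.
  by case: (eqVneq v (f b)) => [->|_]; [rewrite eqxx|move=> /fe].
have [->|va] := eqVneq v a; first by rewrite eq_sym (negPf ab) eqxx.
have [->|vb] := eqVneq v b; first by rewrite eqxx.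
have [vE|vfb] := eqVneq v (f b).
  by rewrite (negPf va) (negPf vb) vE eqxx.
rewrite fK -{1}fa (inj_eq (can_inj fK)) (negPf va).
rewrite -{1}(fK b) (inj_eq (can_inj fK)) (negPf vfb).
by rewrite (inj_eq (can_inj fK)) (negPf vb).
Qed.

Lemma unmatched_rematch (V : finType) (f : {ffun V -> V}) (a b : V) :
  involutive f -> f a = a -> a != b ->
  unmatched (rematch f a b) = (f b |: unmatched f) :\ a :\ b.
Proof.
move=> fK fa ab; apply/setP=> v; rewrite !inE ffunE.
have [->|va] := eqVneq v a; first by rewrite eq_sym (negPf ab) andbF.
have [->|vb] := eqVneq v b; first by rewrite (negPf ab).
by have [->|_] := eqVneq v (f b); rewrite ?eqxx.
Qed.

(** If [b] is matched, [f b] replaces [a] among the unmatched vertices; if [b] is unmatched, both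
    [a] and [b] leave, whence [(f b == b).*2]. *)
Lemma card_unmatched_rematch (V : finType) (f : {ffun V -> V}) (a b : V) :
  involutive f -> f a = a -> a != b -> 
  #|unmatched (rematch f a b)| <= #|unmatched f| - (f b == b).*2.
Proof.
move=> fK fa ab; rewrite unmatched_rematch //.
have aU : a \in unmatched f by rewrite inE fa.
case: (eqVneq (f b) b) => [fb|fb] /=.
  have bU : b \in unmatched f by rewrite inE fb.
  rewrite fb (setUidPr _) ?sub1set //.
  by rewrite (cardsD1 a (unmatched f)) aU (cardsD1 b (_ :\ a)) !inE eq_sym ab /= fb eqxx; lia.
have fbU : f b \notin unmatched f by rewrite inE fK eq_sym.
rewrite subn0; apply: leq_trans (subset_leq_card (subD1set _ _)) _.
have := cardsD1 a (f b |: unmatched f).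
by rewrite in_setU1 aU orbT cardsU1 fbU /=; lia.
Qed.

Definition maximum_matching (V : finType) (e : rel V) (f : {ffun V -> V}) : Prop :=
  matching e f /\ forall g, matching e g -> #|unmatched f| <= #|unmatched g|.

Lemma maximum_matching_exists (V : finType) (e : rel V) :
  exists f, maximum_matching e f.
Proof.
have m0 : matching e [ffun v => v].
  by apply/matchingP; split=> v; rewrite !ffunE ?eqxx.
by case: (arg_minnP (fun f : {ffun V -> V} => #|unmatched f|) m0) => f mf fmin; exists f.
Qed.

Lemma maximum_matching_indep (V : finType) (e : rel V) (f : {ffun V -> V}) :
  symmetric e -> irreflexive e -> maximum_matching e f ->
  {in unmatched f &, forall u v, ~~ e u v}.
Proof.
move=> es ei [mf fmin] u v; rewrite !inE => /eqP fu /eqP fv; apply/negP=> euv.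
have uv : u != v by apply: contraTneq euv => ->; rewrite ei.
have [fK _] := matchingP _ _ mf.
have := fmin _ (rematch_matching es ei mf fu euv).
rewrite leqNgt => /negP[]; apply: leq_ltn_trans (card_unmatched_rematch fK fu uv) _.
have : 0 < #|unmatched f| by apply/card_gt0P; exists u; rewrite inE fu.
by rewrite fv eqxx /=; lia.
Qed.

(** The unmatched vertices of the new matching are again independent by [maximum_matching_indep];
    this excludes longer augmenting paths. *)
Lemma rematch_maximum (V : finType) (e : rel V) (f : {ffun V -> V}) (a b : V) :
  symmetric e -> irreflexive e -> maximum_matching e f -> f a = a -> e a b ->
  maximum_matching e (rematch f a b).
Proof.
move=> es ei [mf fmin] fa eab; split; first exact: rematch_matching.
move=> g mg; have [fK _] := matchingP _ _ mf.
have ab : a != b by apply: contraTneq eab => ->; rewrite ei.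
apply: leq_trans (card_unmatched_rematch fK fa ab) _.
by apply: leq_trans (leq_subr _ _) (fmin _ mg).
Qed.

Lemma perfect_of_matching (V : finType) (e : rel V) (f : {ffun V -> V}) :
  matching e f -> unmatched f = set0 -> perfect_matching e f.
Proof.
move=> /matchingP[fK fe] U0; split=> // v; apply: fe.
by have := in_set0 v; rewrite -U0 inE => ->.
Qed.

(* [S] is a set of universal vertices outside which adjacency is transitive, so
   that the rest of the graph is a disjoint union of cliques.  The classes of
   the unmatched vertices and of the partners of [S] are pairwise distinct, as
   any coincidence gives an augmenting path of length 1, 3 or 5. *)
Lemma maximum_matching_classes (V : finType) (e : rel V) (T : finType)
    (c : V -> T) (S : {set V}) :
  symmetric e -> irreflexive e -> ~~ odd #|V| ->
  (forall f, ~ perfect_matching e f) ->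
  (forall u v, u \in S -> u != v -> e u v) ->
  (forall u v, u \notin S -> v \notin S -> u != v -> c u = c v -> e u v) ->
  #|S| + 2 <= #|c @: ~: S|.
Proof.
move=> es ei evV npm Su Sc; have [f fmax] := maximum_matching_exists e.
have [mf _] := fmax; have [fK fe] := matchingP _ _ mf.
have finj := can_inj fK.
have indep := maximum_matching_indep es ei.
(* The number of unmatched vertices is even by parity, and nonzero since no matching is perfect. *)
have U2 : 1 < #|unmatched f|.
  have := odd_card_involution (A := [set: V]) fK (fun v _ => in_setT _).
  rewrite setTI cardsT (negPf evV).
  case E: #|_| => [|[|m]] //; case: (npm f); apply: perfect_of_matching => //.
  exact: cards0_eq.
have other u : exists2 u', u' \in unmatched f & u' != u.
  have : 0 < #|unmatched f :\ u| by have := cardsD1 u (unmatched f); lia.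
  by case/card_gt0P => u'; rewrite !inE => /andP[? ?]; exists u'; rewrite ?inE.
have US u : u \in unmatched f -> u \notin S.
  move=> uU; apply/negP => uS; have [u' u'U u'u] := other u.
  by have /negP[] := indep _ fmax _ _ uU u'U; apply: Su; rewrite // eq_sym.
have fS_matched s : s \in S -> f s != s.
  by move=> sS; apply: contraTneq sS => fs; apply: US; rewrite inE fs.
(* Otherwise [u, s, f s, u'] is augmenting: matching [u] to [s] frees [f s] while [u'] stays
   unmatched. *)
have aug s u u' : s \in S -> u \in unmatched f -> u' \in unmatched f ->
    u' != u -> ~~ e (f s) u'.
  move=> sS uU u'U u'u; have us : u != s by apply: contraTneq sS => <-; apply: US.
  have u's : u' != s by apply: contraTneq sS => <-; apply: US.
  have fu : f u = u by move: uU; rewrite inE => /eqP.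
  have fu' : f u' = u' by move: u'U; rewrite inE => /eqP.
  have eus : e u s by rewrite es Su // eq_sym.
  apply: (indep _ (rematch_maximum es ei fmax fu eus)); rewrite unmatched_rematch //.
    rewrite !inE eqxx fS_matched //= andbT -fu (inj_eq finj).
    by apply: contraTneq sS => ->; apply: US.
  by rewrite !inE u's u'u fu' eqxx orbT.
have fS s : s \in S -> f s \notin S.
  move=> sS; apply/negP => fsS.
  have [u uU _] := other s; have [u' u'U u'u] := other u.
  have /negP[] := aug _ _ _ sS uU u'U u'u; apply: Su => //.
  by apply: contraTneq fsS => ->; apply: US.
(* [h v] represents the class attached to [v]: [v] itself if unmatched, its partner if [v] lies in
   [S]. *)
pose h v := if f v == v then v else f v.
have cS v : v \in S :|: unmatched f -> h v \notin S.
  rewrite inE /h => /orP[vS|vU]; last by move: (vU); rewrite inE => ->; apply: US.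
  by rewrite (negPf (fS_matched _ vS)); apply: fS.
have cinj : {in S :|: unmatched f &, injective (c \o h)}.
  suff wl v w : v \in S -> w \in S :|: unmatched f -> c (h v) = c (h w) -> v = w.
    move=> v w; have [vS vSU|vS] := boolP (v \in S); first exact: wl.
    have [wS vSU _ /esym E|wS] := boolP (w \in S).
      by apply/esym; apply: wl.
    rewrite in_setU (negPf vS) in_setU (negPf wS) /= => vU wU.
    rewrite /h; move: (vU) (wU); rewrite !inE => -> -> E.
    apply: contraNeq (indep _ fmax _ _ vU wU) => vw.
    by apply: Sc => //; apply: US.
  move=> vS wSU; rewrite /= /h (negPf (fS_matched _ vS)).
  have [wS|wS] := boolP (w \in S).
    rewrite (negPf (fS_matched _ wS)) => E.
    apply/eqP/negPn/negP => vw.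
    have [u uU _] := other v; have [u' u'U u'u] := other u.
    have uS := US _ uU; have u'S := US _ u'U.
    have uv : u != v by apply: contraNneq uS => ->.
    have u'v : u' != v by apply: contraNneq u'S => ->.
    have uw : u != w by apply: contraNneq uS => ->.
    have u'w : u' != w by apply: contraNneq u'S => ->.
    have fu : f u = u by move: uU; rewrite inE => /eqP.
    have fu' : f u' = u' by move: u'U; rewrite inE => /eqP.
    have euv : e u v by rewrite es Su // eq_sym.
    have eu'w : e u' w by rewrite es Su // eq_sym.
    have fv_u : f v != u by rewrite -fu (inj_eq finj) eq_sym.
    have fv_u' : f v != u' by rewrite -fu' (inj_eq finj) eq_sym.
    have fw_u : f w != u by rewrite -fu (inj_eq finj) eq_sym.
    have fw_u' : f w != u' by rewrite -fu' (inj_eq finj) eq_sym.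
    have fvw : f v != w by apply: contraTneq wS => <-; apply: fS.
    have fwv : f w != v by apply: contraTneq vS => <-; apply: fS.
    (* Matching [u] to [v] and then [u'] to [w] frees [f v] and [f w]: the augmenting path is
       [u, v, f v, f w, w, u']. *)
    pose g := rematch f u v.
    have gmax : maximum_matching e g by apply: rematch_maximum.
    have gK : involutive g by have [/matchingP[]] := gmax.
    have gu' : g u' = u'.
      by rewrite ffunE (negPf u'u) (negPf u'v) fu' if_same.
    have gw : g w = f w.
      rewrite ffunE eq_sym (negPf uw) [w == v]eq_sym (negPf vw).
      by rewrite [w == f v]eq_sym (negPf fvw).
    have /negP[] : ~~ e (f v) (f w).
      apply: (indep _ (rematch_maximum es ei gmax gu' eu'w)).
        rewrite unmatched_rematch // gw !inE fvw fv_u' /=.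
        by rewrite ffunE (negPf fv_u) (negPf (fS_matched _ vS)) !eqxx orbT.
      by rewrite unmatched_rematch // gw !inE (negPf (fS_matched _ wS)) fw_u' eqxx.
    by apply: Sc; rewrite ?fS ?(inj_eq finj).
  have wU : w \in unmatched f by move: wSU; rewrite inE (negPf wS).
  move: (wU); rewrite inE => /eqP fw; rewrite fw eqxx => E.
  have [u uU uw] := other w.
  have /negP[] := aug _ _ _ vS uU wU ltac:(by rewrite eq_sym).
  by apply: Sc => //; [exact: fS|rewrite -fw (inj_eq finj); apply: contraTneq vS => ->].
apply: leq_trans (subset_leq_card (_ : (c \o h) @: (S :|: unmatched f) \subset _)).
  rewrite (card_in_imset cinj) cardsU disjoint_setI0 ?cards0 ?subn0 ?leq_add2l //.
  by rewrite disjoints_subset; apply/subsetP => v vS; rewrite inE; apply: contraL vS; apply: US.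
by apply/subsetP => _ /imsetP[v vSU ->]; apply: imset_f; rewrite inE cS.
Qed.

(** * Tutte's theorem through edge-maximal graphs *)

Definition add_edge (V : eqType) (e : rel V) (x z : V) : rel V :=
  fun u v => [|| e u v, (u == x) && (v == z) | (u == z) && (v == x)].

Lemma add_edge_sym (V : eqType) (e : rel V) (x z : V) :
  symmetric e -> symmetric (add_edge e x z).
Proof.
move=> es u v; rewrite /add_edge es; congr (_ || _).
by rewrite orbC andbC [(u == x) && _]andbC.
Qed.

Lemma add_edge_irrefl (V : eqType) (e : rel V) (x z : V) :
  irreflexive e -> x != z -> irreflexive (add_edge e x z).
Proof.
move=> ei xz u; rewrite /add_edge ei; by have [->|_] := eqVneq u x; rewrite ?(negPf xz) ?andbF.
Qed.

(** Being an involution, [g] also preserves the complement of [P]. *)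
Lemma perfect_matching_splice (V : finType) (e : rel V) (P : {set V}) (f g : V -> V) :
  involutive f -> involutive g ->
  (forall v, v \in P -> f v \in P) -> (forall v, v \in P -> g v \in P) ->
  (forall v, v \in P -> e v (f v)) -> (forall v, v \notin P -> e v (g v)) ->
  exists h, perfect_matching e h.
Proof.
move=> fK gK fP gP fe ge; exists (fun v => if v \in P then f v else g v).
split=> v; last by case: ifPn; [exact: fe|exact: ge].
case: (boolP (v \in P)) => vP; first by rewrite fP // fK.
by rewrite ifN ?gK //; apply: contraNN vP => /gP; rewrite gK.
Qed.

(* Walk from [y] along the alternating cycle of the matchings [g] and [f], [g]
   first, up to the first vertex in [{x, z}], if any.  If it is [z], say, match
   [y] to [z], keep [f] on the rest of the walk and [g] outside; if there is
   none, keep [f] on the whole cycle and [g] outside. *)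
Lemma lovasz_exchange (V : finType) (e : rel V) (x y z w : V) (f g : V -> V) :
  symmetric e -> irreflexive e -> e x y -> e y z ->
  perfect_matching (add_edge e x z) f -> perfect_matching (add_edge e y w) g ->
  x != z -> y != w -> exists h, perfect_matching e h.
Proof.
move=> es ei exy eyz [fK fe] [gK ge] xz yw.
have finj := can_inj fK; have ginj := can_inj gK.
have f_fix v : f v != v.
  by apply: contraTneq (fe v) => ->; rewrite (add_edge_irrefl ei xz).
have g_fix v : g v != v.
  by apply: contraTneq (ge v) => ->; rewrite (add_edge_irrefl ei yw).
(* The walk is [p 0, g (p 0), p 1, g (p 1), ...] with [p 0 = y]. *)
pose phi v := f (g v); pose p i := iter i phi y.
have pS i : p i.+1 = f (g (p i)) by [].
have fpS i : f (p i.+1) = g (p i) by rewrite pS fK.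
(* An equality would shrink from both ends, one step at a time, down to a fixed point of [g] or of
   [f]. *)
have odd_cycle j a : g (p (a + j)) != p a.
  have [m] := ubnP j; elim: m j a => // m IH [|[|j]] a ltjm.
  - by rewrite addn0.
  - rewrite addn1 -(inj_eq ginj) gK pS; exact: f_fix.
  - rewrite addnS -(inj_eq ginj) gK -(inj_eq finj) -pS fpS addnS -addSn.
    by apply: IH; lia.
case: (pselect (exists i, g (p i) \in [:: x; z])) => [Ex|NEx]; last first.
  have phi_inj : injective phi by move=> u v /finj/ginj.
  (* The cycle through [y] is the orbit of [y] under [phi] together with its image under [g]. Each
     of its [f]-edges has an end of the form [g (p i)], so none is the added edge between [x] and
     [z]. *)
  pose P := [set v | fconnect phi y v || fconnect phi y (g v)].
  have Pp v : fconnect phi y v -> g v \notin [:: x; z].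
    by move=> /iter_findex <-; apply/negP => H; apply: NEx; exists (findex phi y v).
  have Ppred v : fconnect phi y v -> fconnect phi y (g (f v)).
    move=> yv; apply: connect_trans yv _; rewrite fconnect_sym //.
    by apply: connect1; rewrite /= /phi gK fK.
  have PS v : fconnect phi y (g v) -> fconnect phi y (f v).
    move=> yv; apply: connect_trans yv _.
    by apply: connect1; rewrite /= /phi gK.
  apply: (@perfect_matching_splice _ _ P f g) => // v; rewrite !inE.
  - by case/orP => [/Ppred|/PS] ->; rewrite ?orbT.
  - by rewrite gK orbC.
  - move=> vP; have := fe v; rewrite /add_edge; case: (e v (f v)) => //= vE.
    have [v_xz fv_xz] : v \in [:: x; z] /\ f v \in [:: x; z].
      by case/orP: vE => /andP[/eqP-> /eqP->]; rewrite !inE !eqxx !orbT.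
    case/orP: vP => [/Ppred/Pp|/Pp]; first by rewrite gK fv_xz.
    by rewrite gK v_xz.
  - move=> vP; have := ge v; rewrite /add_edge; case: (e v (g v)) => //=.
    by case/orP => /andP[/eqP E1 /eqP E2]; move: vP; rewrite E2 E1 connect0 ?orbT.
pose m := ex_minn Ex; pose u := g (p m).
have [uxz mmin] : u \in [:: x; z] /\ forall i, g (p i) \in [:: x; z] -> m <= i.
  by rewrite /u /m; case: ex_minnP.
have eyu : e y u by move: uxz; rewrite !inE => /orP[]/eqP->; rewrite // es.
(* The walk from [y] to [u]: [g] preserves it, and [f] preserves it without its two ends. *)
pose P := [set v | [exists i : 'I_m.+1, (v == p i) || (v == g (p i))]].
have inP i v : i <= m -> v = p i \/ v = g (p i) -> v \in P.
  rewrite -ltnS => im vi; rewrite inE; apply/existsP; exists (Ordinal im) => /=.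
  by case: vi => ->; rewrite eqxx ?orbT.
have PE v : v \in P -> exists2 i, i <= m & v = p i \/ v = g (p i).
  rewrite inE => /existsP[i H]; exists (val i); first by rewrite -ltnS ltn_ord.
  by case/orP: H => /eqP; [left|right].
have yP : y \in P by apply: (inP 0) => //; left.
have uP : u \in P by apply: (inP m) => //; right.
have gP v : v \in P -> g v \in P.
  by case/PE => i im [->|->]; apply: (inP i) => //; rewrite ?gK; [right|left].
have fP v : v \in P -> v != y -> v != u -> [/\ f v \in P, f v != y & f v != u].
  case/PE => i im [->|->] vy vu.
    case: i im vy vu => [|i] im vy vu; first by rewrite eqxx in vy.
    rewrite fpS; split; first by apply: (inP i); [exact: ltnW|right].
      exact: (odd_cycle i 0).
    by apply: contraTneq uxz => <-; apply/negP => /mmin; lia.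
  have ltim : i < m by rewrite ltn_neqAle im andbT; apply: contraNneq vu => ->.
  rewrite -pS; split; first by apply: (inP i.+1) => //; left.
    apply: contraTneq uxz => E; rewrite /u -(subnK ltim) {1}/p iterD -/(p _) E.
    by apply/negP => /mmin; lia.
  by rewrite eq_sym /u -(subnKC ltim); apply: odd_cycle.
have uy : u != y by apply: contraTneq eyu => ->; rewrite ei.
exists (fun v => if v == y then u else if v == u then y
                 else if v \in P then f v else g v); split=> v.
  have [->|vy] := eqVneq v y; first by rewrite (negPf uy) eqxx.
  have [->|vu] := eqVneq v u; first by rewrite eqxx.
  case: (boolP (v \in P)) => vP.
    by have [fvP /negPf-> /negPf->] := fP _ vP vy vu; rewrite fvP fK.
  have gvP : g v \notin P by apply: contraNN vP => /gP; rewrite gK.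
  rewrite ifN; last by apply: contraNneq gvP => ->.
  rewrite ifN; last by apply: contraNneq gvP => ->.
  by rewrite (negPf gvP) gK.
have [->//|vy] := eqVneq v y.
have [->|vu] := eqVneq v u; first by rewrite es.
case: ifPn => vP.
  have [_ _ fvu] := fP _ vP vy vu; have := fe v; rewrite /add_edge.
  case: (e v (f v)) => //= vE; move: vu fvu uxz; rewrite !inE.
  by case/orP: vE => /andP[/eqP-> /eqP->]; rewrite ![u == _]eq_sym => /negPf-> /negPf->.
have := ge v; rewrite /add_edge (negPf vy) andFb; case: (e v (g v)) => //=.
by case/andP=> _ /eqP gv; move: vP; rewrite -(gK v) gv gP.
Qed.

(* Lovász's proof of Tutte's theorem: enlarge the graph to one which is
   edge-maximal without a perfect matching; there the non-universal vertices
   form disjoint cliques. *)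
Lemma tutte_classes (V : finType) (e : rel V) :
  symmetric e -> irreflexive e -> ~~ odd #|V| ->
  (forall f, ~ perfect_matching e f) ->
  exists (S : {set V}) (c : V -> {set V}),
    (forall u v, u \notin S -> v \notin S -> e u v -> c u = c v) /\
    #|S| + 2 <= #|c @: ~: S|.
Proof.
move=> es ei evV; have [m] := ubnP #|[pred p : V * V | ~~ e p.1 p.2]|.
elim: m e es ei => // m IH e es ei ltem npm.
case: (pselect (exists x z, [/\ x != z, ~~ e x z &
         forall f, ~ perfect_matching (add_edge e x z) f])) => [|maximal].
  move=> [x [z [xz nexz npm']]].
  have [||//|//|S [c [ce cS]]] := IH (add_edge e x z).
  - exact: add_edge_sym.
  - exact: add_edge_irrefl.
  - rewrite -ltnS; apply: leq_trans ltem; rewrite ltnS; apply: proper_card.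
    apply/properP; split.
      by apply/subsetP => p; rewrite !inE /add_edge negb_or => /andP[].
    by exists (x, z); rewrite !inE //= /add_edge !eqxx orbT.
  exists S, c; split=> // u v uS vS euv; apply: ce => //.
  by rewrite /add_edge euv.
have addP x z : x != z -> ~~ e x z -> exists f, perfect_matching (add_edge e x z) f.
  move=> xz nexz; apply: contrapT => H; apply: maximal; exists x, z.
  by split=> // f mf; apply: H; exists f.
pose S := [set u | [forall v, (u != v) ==> e u v]].
have Su u v : u \in S -> u != v -> e u v.
  by rewrite inE => /forallP/(_ v)/implyP.
(* Being outside [S], [y] has a non-neighbour [w]; adding either missing edge, [x z] or [y w],
   creates a perfect matching, and the exchange lemma combines the two. *)
have etrans x y z : y \notin S -> e x y -> e y z -> x != z -> e x z.
  rewrite inE => /forallPn[w]; rewrite negb_imply => /andP[yw neyw] exy eyz xz.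
  apply/negPn/negP => nexz.
  have [f mf] := addP _ _ xz nexz; have [g mg] := addP _ _ yw neyw.
  by have [h /npm] := lovasz_exchange es ei exy eyz mf mg xz yw.
(* By [etrans] the closed neighbourhoods outside [S] are disjoint cliques, and they serve as their
   own labels. *)
pose c u := [set v | (v \notin S) && ((v == u) || e u v)].
have ceq u v : u \notin S -> v \notin S -> e u v -> c u \subset c v.
  move=> uS vS euv; apply/subsetP => a; rewrite !inE => /andP[-> /orP[/eqP->|eua]].
    by rewrite es euv orbT.
  by case: eqVneq => //= av; apply: (etrans _ u); rewrite // 1?es // eq_sym.
exists S, c; split.
  by move=> u v uS vS euv; apply/eqP; rewrite eqEsubset !ceq // es.
apply: (maximum_matching_classes es ei evV npm Su) => u v uS vS uv cuv.
have : u \in c u by rewrite /c in_set uS eqxx.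
by rewrite cuv /c in_set (negPf uv) /= es => /andP[].
Qed.

(** Each vertex lies on exactly one edge [{v, f v}]; these edges get weight [k] and all others
    [0]. *)
Lemma perfect_k_matching_of_perfect (G : sgraph) (k : nat) (f : G -> G) :
  perfect_matching (@adj G) f -> has_perfect_k_matching G k.
Proof.
move=> [fK fe].
pose F (e : edge G) : 'I_k.+1 :=
  if [exists v, val e == [set v; f v]] then ord_max else ord0.
have wF v : weight_at F v = k.
  have vE : [set v; f v] \in edges G.
    by rewrite inE; apply/existsP; exists v; apply/existsP; exists (f v); rewrite fe /=.
  pose e0 : edge G := Sub [set v; f v] vE.
  rewrite /weight_at (bigD1 e0) /=; last by rewrite !inE eqxx.
  rewrite [X in _ + X]big1 ?addn0.
    by rewrite /F ifT //; apply/existsP; exists v => /=.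
  move=> e /andP[ve neq]; rewrite /F ifN //; apply: contraNN neq.
  move=> /existsP[u /eqP uE]; apply/eqP/val_inj => /=; rewrite uE.
  move: ve; rewrite uE !inE => /orP[]/eqP-> //.
  by rewrite fK setUC.
by exists F; split=> // v; rewrite wF.
Qed.

Import Order.TTheory GRing.Theory Num.Theory.
Local Open Scope ring_scope.

(** * Eigenvectors as functions on vertices, and Perron's argument *)

Lemma eigenvalue_adjacencyP (R : realType) (G : sgraph) (a : R) :
  eigenvalue (adjacency R G) a <->
  exists2 y : G -> R, exists v, y v != 0 &
    forall v, \sum_(u | adj u v) y u = a * y v.
Proof.
have rowE (w : 'rV[R]_#|G|) v :
    (w *m adjacency R G) 0 (enum_rank v) =
    \sum_(u | adj u v) w 0 (enum_rank u).
  rewrite !mxE (reindex (@enum_rank G)) /=; last exact/onW_bij/enum_rank_bij.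
  rewrite [RHS]big_mkcond; apply: eq_bigr => u _.
  by rewrite !mxE !enum_rankK; case: adj; rewrite ?mulr1 ?mulr0.
split=> [/eigenvalueP[w wA w0]|[y [v yv] yE]].
  exists (fun u => w 0 (enum_rank u)) => [|v]; last by rewrite -rowE wA mxE.
  apply: contrapT => H; case/eqP: w0; apply/rowP => i; rewrite mxE.
  apply: contrapT => /eqP wi; apply: H; exists (enum_val i).
  by rewrite enum_valK.
apply/eigenvalueP; exists (\row_i y (enum_val i)).
  apply/rowP => i; rewrite -(enum_valK i) rowE !mxE enum_rankK -yE.
  by apply: eq_bigr => u _; rewrite mxE enum_rankK.
by apply: contraNneq yv => /rowP/(_ (enum_rank v)); rewrite !mxE enum_rankK => ->.
Qed.

(* Pairing the modulus [z] of an eigenvector with [y] makes every inequality in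
   [rho z <= A z] and [A y <= mu y] tight; then [A z = rho z], so the zero set of
   [z] is closed under adjacency and hence empty. *)
Lemma supersolution_tight (R : realType) (G : sgraph) (y : G -> R) (mu rho : R) :
  connected_off (set0 : {set G}) -> (forall v, 0 < y v) ->
  (forall v, \sum_(u | adj u v) y u <= mu * y v) ->
  eigenvalue (adjacency R G) rho -> mu <= rho ->
  forall v, \sum_(u | adj u v) y u = mu * y v.
Proof.
move=> conn y0 yle /eigenvalue_adjacencyP[x [v0 xv0] xE] murho.
pose z v := `|x v|.
have z0 v : 0 <= z v by exact: normr_ge0.
have zle v : rho * z v <= \sum_(u | adj u v) z u.
  apply: le_trans (ler_norm_sum _ _ _); rewrite xE normrM.
  by apply: ler_wpM2r; [exact: z0|exact: ler_norm].
(* With [A] the adjacency operator, [T v] simplifies to [(A z) v * y v - z v * (A y) v], which sums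
   to zero as [A] is symmetric; its three terms are nonnegative, so all vanish. *)
pose T v := (\sum_(u | adj u v) z u - rho * z v) * y v
  + z v * (mu * y v - \sum_(u | adj u v) y u) + (rho - mu) * z v * y v.
have T1 v : 0 <= (\sum_(u | adj u v) z u - rho * z v) * y v.
  by apply: mulr_ge0; rewrite ?subr_ge0 // ltW.
have T2 v : 0 <= z v * (mu * y v - \sum_(u | adj u v) y u).
  by apply: mulr_ge0; rewrite ?subr_ge0.
have T3 v : 0 <= (rho - mu) * z v * y v.
  by rewrite !mulr_ge0 ?subr_ge0 // ltW.
have sumT : \sum_v T v = 0.
  have -> : \sum_v T v = \sum_v (\sum_(u | adj u v) z u) * y v
                        - \sum_v z v * (\sum_(u | adj u v) y u).
    by rewrite -sumrB; apply: eq_bigr => v _; rewrite /T; ring.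
  apply/eqP; rewrite subr_eq0; apply/eqP.
  under eq_bigr do rewrite mulr_suml.
  under [RHS]eq_bigr do rewrite mulr_sumr.
  rewrite (exchange_big_dep xpredT) //=; apply: eq_bigr => v _.
  by apply: eq_bigl => u; rewrite adj_sym.
have Tv v : T v = 0.
  by apply: (psumr_eq0P _ sumT) => // u _; rewrite !addr_ge0.
have zA v : \sum_(u | adj u v) z u = rho * z v.
  have : (\sum_(u | adj u v) z u - rho * z v) * y v == 0.
    by have := Tv v; have := T1 v; have := T2 v; have := T3 v; rewrite /T eq_le; lra.
  by rewrite mulf_eq0 (gt_eqF (y0 v)) orbF subr_eq0 => /eqP.
have zpos v : z v != 0.
  have cl : closed [rel u v | [&& u \notin set0, v \notin set0 & adj u v]]
                   [pred v : G | z v == 0].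
    have step u w : adj u w -> z u == 0 -> z w == 0.
      move=> uw /eqP zu; have := zA u; rewrite zu mulr0 => /psumr_eq0P H.
      by apply/eqP; apply: H; rewrite // adj_sym.
    move=> u w /= /and3P[_ _ uw]; rewrite !inE.
    by apply/idP/idP; apply: step; rewrite // adj_sym.
  have := closed_connect cl (conn v0 v _ _); rewrite !inE => /(_ isT isT) <-.
  by rewrite /z normr_eq0.
move=> v; have : z v * (mu * y v - \sum_(u | adj u v) y u) == 0.
  by have := Tv v; have := T1 v; have := T2 v; have := T3 v; rewrite /T eq_le; lra.
by rewrite mulf_eq0 (negPf (zpos v)) subr_eq0 => /eqP.
Qed.

(** * The supersolution attached to separated classes *)

Lemma ler_sum_subpred (R : realType) (I : finType) (P Q : pred I) (y : I -> R) :
  (forall i, 0 < y i) -> subpred P Q -> \sum_(i | P i) y i <= \sum_(i | Q i) y i.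
Proof.
move=> y0 PQ; rewrite [leLHS]big_mkcond [leRHS]big_mkcond; apply: ler_sum => i _.
by case: ifP => [/PQ->//|_]; case: ifP => // _; exact: ltW.
Qed.

Lemma eq_sum_subpred (R : realType) (I : finType) (P Q : pred I) (y : I -> R) :
  (forall i, 0 < y i) -> subpred P Q ->
  \sum_(i | Q i) y i <= \sum_(i | P i) y i -> subpred Q P.
Proof.
move=> y0 PQ le i Qi; apply/negPn/negP => Pi; move: le; apply/negP; rewrite -ltNge.
rewrite (bigD1 i Qi) /=; apply: ltr_pwDl => //.
by apply: ler_sum_subpred => // j Pj; rewrite PQ //; apply: contraNneq Pi => <-.
Qed.

(** At least [k] other parts exist, each of size at least [1]. *)
Lemma leq_part (I : finType) (A : {set I}) (m : I -> nat) (M k : nat) (i : I) :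
  (forall j, j \in A -> (0 < m j)%N) -> (k < #|A|)%N ->
  (\sum_(j in A) m j = M + k)%N -> i \in A -> (m i <= M)%N.
Proof.
move=> m0 kA sumA iA; have := sumA; rewrite (bigD1 i iA) /=.
have : (#|A :\ i| <= \sum_(j in A | j != i) m j)%N.
  rewrite -sum1_card (eq_bigl (fun j => (j \in A) && (j != i))); last first.
    by move=> j; rewrite !inE andbC.
  by apply: leq_sum => j /andP[/m0].
have := cardsD1 i A; rewrite iA /= add1n; move: kA.
by set a := #|A|; set b := #|A :\ i|; set c := (\sum_(j in _ | _) _)%N; lia.
Qed.

(* [x / (mu + 1 - x)] is convex with value [0] at [0], so for a given total the
   sum is largest when all parts but one equal [1] and the parts are as few as
   possible. *)
Lemma sum_class_weights (R : realType) (I : finType) (A : {set I}) (m : I -> nat)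
    (M k : nat) (mu : R) :
  (forall i, i \in A -> (0 < m i)%N) -> (k < #|A|)%N ->
  (\sum_(i in A) m i = M + k)%N -> (0 < M)%N -> 0 < mu -> M%:R < mu + 1 ->
  [/\ forall i, i \in A -> (m i <= M)%N,
      \sum_(i in A) (m i)%:R / (mu + 1 - (m i)%:R) <= k%:R / mu + M%:R / (mu + 1 - M%:R)
    & k%:R / mu + M%:R / (mu + 1 - M%:R) <= \sum_(i in A) (m i)%:R / (mu + 1 - (m i)%:R) ->
      #|A| = k.+1 /\ forall i, i \in A -> m i = 1%N \/ m i = M].
Proof.
move=> m0 kA sumA M0 mu0 Mmu.
have mM i (iA : i \in A) := leq_part m0 kA sumA iA.
(* [beta] is the slope of the chord of [x / (mu + 1 - x)] from [x = 1] to [x = M], in a form that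
   also makes sense for [M = 1]; [slack i] below is the height of the chord above the function at
   [m i]. *)
pose beta := (mu + 1) / (mu * (mu + 1 - M%:R)).
pose slack i := 1 / mu + ((m i)%:R - 1) * beta - (m i)%:R / (mu + 1 - (m i)%:R).
have MmuP : 0 < mu + 1 - M%:R by lra.
have mmu i : i \in A -> 0 < mu + 1 - (m i)%:R.
  by move=> /mM; rewrite -(ler_nat R); lra.
have slackE i : i \in A -> slack i = ((m i)%:R - 1) * (mu + 1) / mu
    * (M%:R - (m i)%:R) / ((mu + 1 - M%:R) * (mu + 1 - (m i)%:R)).
  move=> iA; rewrite /slack /beta; field.
  by rewrite !gt_eqF // mmu.
have slack0 i : i \in A -> 0 <= slack i.
  move=> iA; rewrite slackE //.
  have := mM _ iA; rewrite -(ler_nat R) => mMi.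
  have := m0 _ iA; rewrite -(ler_nat R) => mi1.
  have := mmu _ iA => mui.
  have mu1 : 0 < mu + 1 by lra.
  apply: divr_ge0; last by rewrite mulr_ge0 // ltW.
  by rewrite mulr_ge0 ?subr_ge0 // divr_ge0 ?mulr_ge0 ?subr_ge0 // ltW.
have betaE : 1 / mu < beta.
  rewrite /beta ltr_pdivlMr ?mulr_gt0 // mulrA mul1r mulVf ?gt_eqF // mul1r.
  by have : (1 : R) <= M%:R by [rewrite (ler_nat R 1)]; lra.
(* The bound is missed by [beta - 1 / mu] for each part beyond [k.+1], plus the total slack;
   equality makes both vanish. *)
have sumE : \sum_(i in A) (m i)%:R / (mu + 1 - (m i)%:R) =
    k%:R / mu + M%:R / (mu + 1 - M%:R)
    - (#|A|%:R - k.+1%:R) * (beta - 1 / mu) - \sum_(i in A) slack i.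
  apply/eqP; rewrite eq_sym subr_eq eq_sym -big_split /=.
  under eq_bigr do rewrite /slack addrC subrK.
  rewrite big_split /= sumr_const -mulr_suml big_split /= sumrN sumr_const.
  rewrite -natr_sum sumA natrD -[(1 / mu) *+ _]mulr_natl -natr1 /beta.
  by apply/eqP; field; rewrite !gt_eqF.
have slackS : 0 <= \sum_(i in A) slack i by exact: sumr_ge0.
have kA' : 0 <= #|A|%:R - k.+1%:R :> R by rewrite subr_ge0 ler_nat.
have betaP : 0 < beta - 1 / mu by rewrite subr_gt0.
have prod0 : 0 <= (#|A|%:R - k.+1%:R) * (beta - 1 / mu) by rewrite mulr_ge0 // ltW.
split=> //; first by rewrite sumE; lra.
rewrite sumE => le.
have e1 : (#|A|%:R - k.+1%:R) * (beta - 1 / mu) = 0 by lra.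
have e2 : \sum_(i in A) slack i = 0 by lra.
split.
  move/eqP: e1; rewrite mulf_eq0 (gt_eqF betaP) orbF subr_eq0 eqr_nat.
  by move/eqP.
move=> i iA; have /eqP := psumr_eq0P slack0 e2 iA.
have mu1 : 0 < mu + 1 by lra.
rewrite slackE // !mulf_eq0 !invr_eq0 mulf_eq0 (gt_eqF MmuP) (gt_eqF (mmu _ iA)).
rewrite (gt_eqF mu0) (gt_eqF mu1).
rewrite !orbF !subr_eq0 eqr_nat (eqr_nat _ _ 1) => /orP[]/eqP.
  by left.
by right.
Qed.

(** Outside [S] the vector satisfies the eigenvalue equation exactly in the graph with all permitted
    edges; on [S] the bound by [mu] gives the inequality. Once all is tight, positivity forces every
    permitted edge to be present. *)
Lemma separated_classes_tight (R : realType) (G : sgraph) (T : finType) (c : G -> T)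
    (S : {set G}) (M : nat) (mu rho : R) :
  connected_off (set0 : {set G}) ->
  (forall u v, u \notin S -> v \notin S -> adj u v -> c u = c v) ->
  (#|S| + 2 <= #|c @: ~: S|)%N -> (0 < #|S|)%N -> #|G| = (M + 2 * #|S| + 1)%N ->
  0 < mu -> M%:R < mu + 1 ->
  #|S|%:R - 1 + #|S|%:R * (#|S|.+1%:R / mu + M%:R / (mu + 1 - M%:R)) <= mu ->
  eigenvalue (adjacency R G) rho -> mu <= rho ->
  [/\ mu <= #|S|%:R - 1 + #|S|%:R * (#|S|.+1%:R / mu + M%:R / (mu + 1 - M%:R)),
      forall u v, u \in S -> u != v -> adj u v,
      forall u v, u \notin S -> v \notin S -> u != v -> c u = c v -> adj u v,
      #|c @: ~: S| = #|S|.+2 &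
      forall C, C \in c @: (~: S) ->
        #|[set u in ~: S | c u == C]| = 1%N \/ #|[set u in ~: S | c u == C]| = M].
Proof.
move=> conn cadj cardC S0 cardG mu0 Mmu mule eig murho.
pose fib C := #|[set u in ~: S | c u == C]|; pose s : R := #|S|%:R.
have s0 : 0 < s by rewrite ltr0n.
have cardCS : #|~: S| = (M + #|S|.+1)%N by have := cardsC S; lia.
have M0 : (0 < M)%N by have := leq_imset_card c (~: S); lia.
have fibP C : C \in c @: (~: S) -> (0 < fib C)%N.
  by case/imsetP => u uS ->; apply/card_gt0P; exists u; rewrite inE uS eqxx.
have fib_sum : (\sum_(C in c @: ~: S) fib C = M + #|S|.+1)%N.
  rewrite -cardCS -sum1_card (partition_big_imset c); apply: eq_bigr => C _.
  by rewrite /fib -sum1_card; apply: eq_bigl => u; rewrite inE.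
have cardC' : (#|S|.+1 < #|c @: ~: S|)%N by lia.
have [fibM wle weq] := sum_class_weights fibP cardC' fib_sum M0 mu0 Mmu.
(* Solution of [mu * w = s + (fib C - 1) * w], the equation at a vertex of a clique of size [fib C]
   joined to [S]. *)
pose w C : R := s / (mu + 1 - (fib C)%:R).
have cC v : v \notin S -> c v \in c @: ~: S by move=> vS; rewrite imset_f // inE.
have wden v : v \notin S -> 0 < mu + 1 - (fib (c v))%:R.
  by move=> /cC/fibM; rewrite -(ler_nat R); lra.
pose y v : R := if v \in S then 1 else w (c v).
have y0 v : 0 < y v.
  by rewrite /y; case: ifPn => // vS; apply: divr_gt0; rewrite ?wden.
have ySE (v : G) : v \in S -> y v = 1 by rewrite /y => ->.
have yCE v : v \notin S -> y v = w (c v) by rewrite /y => /negPf->.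
have sumS : \sum_(u in S) y u = s.
  by rewrite (eq_bigr _ ySE) sumr_const.
have sumfib C : \sum_(u in ~: S | c u == C) y u = (fib C)%:R * w C.
  rewrite (eq_bigr (fun=> w C)); last first.
    by move=> u /andP[]; rewrite inE => uS /eqP <-; apply: yCE.
  rewrite mulr_natl -sumr_const; by apply: eq_bigl => u; rewrite inE.
have sumW : \sum_(u in ~: S) y u =
    s * \sum_(C in c @: ~: S) (fib C)%:R / (mu + 1 - (fib C)%:R).
  rewrite (partition_big_imset c) mulr_sumr; apply: eq_bigr => C _.
  by rewrite sumfib /w mulrCA.
have sumT v : v \in S -> \sum_(u | u != v) y u = s - 1 + \sum_(u in ~: S) y u.
  move=> vS; have : \sum_u y u = s + \sum_(u in ~: S) y u.
    rewrite (bigID [in S]) /= sumS; congr (_ + _).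
    by apply: eq_bigl => u; rewrite inE.
  by rewrite (bigD1 v) //= ySE //; lra.
have subT v : subpred (fun u => adj u v) (fun u : G => u != v).
  by move=> u uv; apply: contraTneq uv => ->; rewrite adj_irrefl.
(* The largest neighbourhood that a vertex [v] outside [S] can have. *)
pose Q v u := ((u \in S) || (c u == c v)) && (u != v).
have sumQ v : v \notin S -> \sum_(u | Q v u) y u = mu * y v.
  move=> vS; have : \sum_(u | (u \in S) || (c u == c v)) y u = s + (fib (c v))%:R * w (c v).
    rewrite (bigID [in S]) /= -sumS -sumfib; congr (_ + _).
      by apply: eq_bigl => u; case: (u \in S); rewrite ?andbF.
    by apply: eq_bigl => u; rewrite inE; case: (u \in S); rewrite ?andbF ?andbT.
  rewrite (bigD1 v) /=; last by rewrite eqxx orbT.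
  rewrite /Q yCE // => E.
  have -> : mu * w (c v) = s + (fib (c v))%:R * w (c v) - w (c v).
    by rewrite /w; field; rewrite gt_eqF // wden.
  by rewrite -E addrAC subrr add0r.
have subQ v : v \notin S -> subpred (fun u => adj u v) (Q v).
  move=> vS u uv; rewrite /Q subT // andbT; case: (boolP (u \in S)) => //= uS.
  by apply/eqP; apply: cadj.
have Wle : \sum_(u in ~: S) y u <= s * (#|S|.+1%:R / mu + M%:R / (mu + 1 - M%:R)).
  by rewrite sumW ler_pM2l.
have yle v : \sum_(u | adj u v) y u <= mu * y v.
  case: (boolP (v \in S)) => vS; last by rewrite -sumQ //; apply: ler_sum_subpred; auto.
  rewrite ySE // mulr1; apply: le_trans (_ : \sum_(u | u != v) y u <= _).
    exact: ler_sum_subpred.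
  by rewrite sumT //; apply: le_trans mule; rewrite lerD2l.
have yE := supersolution_tight conn y0 yle eig murho.
have S_tight v : v \in S -> mu <= \sum_(u | u != v) y u.
  by move=> vS; rewrite -[leLHS]mulr1 -(ySE _ vS) -yE; apply: ler_sum_subpred.
have [v0 v0S] := card_gt0P S0.
have S_tight0 := S_tight _ v0S; rewrite sumT // in S_tight0.
(* Tightness at one vertex of [S] puts the class sum at its maximum. *)
have [|cardCE fibE] := weq.
  rewrite -(ler_pM2l s0) -sumW; move: mule S_tight0; rewrite -/s; lra.
split=> //.
- by apply: le_trans S_tight0 _; rewrite lerD2l.
- move=> u v uS uv; rewrite adj_sym.
  apply: (eq_sum_subpred y0 (@subT u)); last by rewrite eq_sym.
  rewrite yE ySE // mulr1 sumT //; apply: le_trans mule; by rewrite lerD2l.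
- move=> u v uS vS uv cuv.
  apply: (eq_sum_subpred y0 (subQ _ vS)); first by rewrite yE sumQ.
  by rewrite /Q cuv eqxx orbT.
Qed.

(** * Isomorphism with the extremal graph *)

Lemma in_card_bij (T : finType) (A : {set T}) (m : nat) :
  #|A| = m -> (0 < m)%N -> exists (f : T -> 'I_m) (g : 'I_m -> T),
    [/\ forall i, g i \in A, cancel g f & {in A, cancel f g}].
Proof.
move=> <- A0; have [x0 x0A] := card_gt0P A0.
(* [x0A] supplies the value of the total function [f] outside [A]. *)
exists (enum_rank_in x0A), (@enum_val _ (mem A)); split.
- exact: enum_valP.
- exact: enum_valK_in.
- by move=> x xA; rewrite enum_rankK_in.
Qed.

(** Vertices outside [S] and [K] become the isolated ones; [2 * t + 1 < n] keeps [K] nonempty for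
    [in_card_bij]. *)
Lemma extremal_graph_iso (G : sgraph) (n t : nat) (S K : {set G}) :
  (0 < t)%N -> (2 * t + 1 < n)%N -> #|G| = n -> #|S| = t ->
  #|K| = (n - 2 * t - 1)%N -> [disjoint S & K] ->
  (forall u v, adj u v = (u != v) && [|| u \in S, v \in S | (u \in K) && (v \in K)]) ->
  sgraph_iso G (extremal_graph n t).
Proof.
move=> t0 tn cardG cardS cardK SK adjE.
have cardL : #|~: (S :|: K)| = t.+1.
  have := cardsC (S :|: K); rewrite cardsU (disjoint_setI0 SK) cards0; lia.
have [fS [gS [gSS gSK fSK]]] := in_card_bij cardS t0.
have [|fK [gK [gKK gKK' fKK]]] := in_card_bij cardK; first by lia.
have [|fL [gL [gLL gLK fLK]]] := in_card_bij cardL; first by [].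
have gKS i : gK i \notin S.
  by apply/negP => H; have := disjointFr SK H; rewrite gKK.
have gSK' i : gS i \notin K by rewrite (disjointFr SK (gSS i)).
have gLSK i : (gL i \notin S) /\ (gL i \notin K).
  by have := gLL i; rewrite !inE negb_or => /andP.
have gLS i := (gLSK i).1; have gLK' i := (gLSK i).2.
pose f (v : G) : extremal_graph n t :=
  if v \in S then inl (fS v)
  else if v \in K then inr (inl (fK v)) else inr (inr (fL v, ord0)).
pose g (v : extremal_graph n t) : G :=
  match v with
  | inl i => gS i
  | inr (inl i) => gK i
  | inr (inr (i, _)) => gL i
  end.
have gf : cancel f g.
  move=> v; rewrite /f; case: ifPn => vS /=; first exact: fSK.
  case: ifPn => vK /=; first exact: fKK.
  by apply: fLK; rewrite !inE negb_or vS.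
have fg : cancel g f.
  case=> [i|[i|[i j]]]; rewrite /f /=.
  - by rewrite gSS gSK.
  - by rewrite (negPf (gKS i)) gKK gKK'.
  - by rewrite (negPf (gLS i)) (negPf (gLK' i)) gLK (ord1 j).
exists f; first by exists g.
suff H a b : adj (g a) (g b) = adj a b by move=> u v; rewrite -H !gf.
rewrite adjE (can_eq fg).
case: a b => [i|[i|[i i']]] [j|[j|[j j']]] /=;
  rewrite ?gSS ?gKK ?(negPf (gKS _)) ?(negPf (gLS _)) ?(negPf (gLK' _)) ?orbT ?andbT ?andbF //=.
by rewrite /copies_adj /= /complete_adj !ord1 eqxx andbF.
Qed.

(** * The quotient polynomial and the eigenvalue [mu] *)

(* The characteristic polynomial of the quotient matrix of
   [K_s \/ (K_{n-2s-1} \cup (s+1) K_1)] on its three vertex classes. *)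
Definition quotient_char (R : realType) (n s x : R) : R :=
  (x - (n - 2 * s - 2)) * (x ^+ 2 - (s - 1) * x - s * (s + 1)) - s * (n - 2 * s - 1) * x.

(** The left side is the slack of the supersolution at a vertex of [S] in the worst case, so the
    sign of [quotient_char] decides the inequality there. *)
Lemma quotient_charE (R : realType) (n s x : R) :
  0 < x -> 0 < x - (n - 2 * s - 2) ->
  x - (s - 1 + s * ((s + 1) / x + (n - 2 * s - 1) / (x + 1 - (n - 2 * s - 1)))) =
  quotient_char n s x / (x * (x - (n - 2 * s - 2))).
Proof.
move=> x0 d0; have -> : x + 1 - (n - 2 * s - 1) = x - (n - 2 * s - 2) by ring.
by rewrite /quotient_char; field; rewrite !gt_eqF.
Qed.

(* [quotient_char n s x - quotient_char n t x] is [s - t] times an expression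
   concave in [s]; it is split below along its chord, whose value at the
   endpoint [s = (n - 2) / 2] is positive by [5 t + 3 <= n]. *)
Lemma quotient_char_gt0 (R : realType) (n s t x : R) :
  1 <= t -> t < s -> 2 * s + 2 <= n -> 5 * t + 3 <= n -> n - t - 2 <= x ->
  quotient_char n t x = 0 -> 0 < quotient_char n s x.
Proof.
move=> t1 ts sn tn xn phi0; pose h := (n - 2) / 2; pose x0 := n - t - 2.
have nE : n = 2 * h + 2 by rewrite /h; lra.
have hs : s <= h by rewrite /h; lra.
(* The cofactor of [s - t] at [s = h] and [x = x0]. *)
pose B := x0 * (x0 - h - t) - 2 * t * (t + 1).
have B0 : 0 < B.
  have x0h : x0 = 2 * h - t by rewrite /x0 nE; lra.
  have h5 : 5 * t + 1 <= 2 * h by lra.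
  rewrite /B x0h.
  (* The right side minus [4 * t * (t + 1)] is [2 * B], which is thus at least [t + 1]. *)
  have : (4 * t + 1) * (t + 1) <= (2 * h - t) * (2 * h - 4 * t).
    by apply: ler_pM; lra.
  by nra.
suff qE : quotient_char n s x = (s - t) * (2 * (s - t) * (h - s) + (h - s) * (x0 + 4 * t + 2)
    + B + (x - x0) * (x0 - s - t + x)) + quotient_char n t x.
  rewrite qE phi0 addr0; apply: mulr_gt0; first by lra.
  have p1 : 0 <= 2 * (s - t) * (h - s) by apply: mulr_ge0; [apply: mulr_ge0|]; lra.
  have p2 : 0 <= (h - s) * (x0 + 4 * t + 2) by apply: mulr_ge0; rewrite /x0; lra.
  have p3 : 0 <= (x - x0) * (x0 - s - t + x) by apply: mulr_ge0; rewrite /x0; lra.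
  by lra.
by rewrite /quotient_char /B /x0 nE; ring.
Qed.

(** Intermediate values: [n - t - 2] is the spectral radius of the subgraph [K_{n-t-1}] of the
    extremal graph; the polynomial is nonpositive there and nonnegative at [n]. *)
Lemma quotient_char_root (R : realType) (n t : R) :
  1 <= t -> 5 * t + 3 <= n ->
  exists2 x : R, n - t - 2 <= x & quotient_char n t x = 0.
Proof.
move=> t1 tn.
pose p : {poly R} := ('X - (n - 2 * t - 2)%:P)
  * ('X ^+ 2 - (t - 1)%:P * 'X - (t * (t + 1))%:P) - (t * (n - 2 * t - 1))%:P * 'X.
have pE x : p.[x] = quotient_char n t x by rewrite /p /quotient_char !hornerE.
have [||x /andP[xge _] /rootP px] := @poly_ivt R p (n - t - 2) n.
- by lra.
- rewrite !pE; apply/andP; split.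
    have -> : quotient_char n t (n - t - 2) = - (t ^+ 2 * (t + 1)).
      by rewrite /quotient_char; ring.
    by rewrite oppr_le0 mulr_ge0 ?sqr_ge0 //; lra.
  rewrite /quotient_char.
  have -> : (n - (n - 2 * t - 2)) * (n ^+ 2 - (t - 1) * n - t * (t + 1))
    - t * (n - 2 * t - 1) * n = n * (n + 1) * (t + 2) - 2 * t * (t + 1) ^+ 2 by ring.
  have nt : (t + 1) * (2 * (t + 1)) <= n * (n + 1) by apply: ler_pM; lra.
  have : (t + 1) * (2 * (t + 1)) * (t + 2) <= n * (n + 1) * (t + 2).
    by apply: ler_wpM2r; lra.
  by have := sqr_ge0 (t + 1); nra.
by exists x; rewrite // -pE.
Qed.

(** The eigenvector takes the values [1], [b], [d] on the three parts; [b] and [d] solve the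
    equations off [K_t], and the last hypothesis is the equation on [K_t]. *)
Lemma extremal_graph_eigenvalue (R : realType) (n t : nat) (mu : R) :
  (0 < t)%N -> 0 < mu -> (n - 2 * t - 1)%:R < mu + 1 ->
  t%:R - 1 + t%:R * (t.+1%:R / mu
    + (n - 2 * t - 1)%:R / (mu + 1 - (n - 2 * t - 1)%:R)) = mu ->
  eigenvalue (adjacency R (extremal_graph n t)) mu.
Proof.
move=> t0 mu0; set M := (n - 2 * t - 1)%N => Mmu muE.
have D0 : mu + 1 - M%:R != 0 by rewrite gt_eqF //; lra.
apply/eigenvalue_adjacencyP.
pose b : R := t%:R / (mu + 1 - M%:R); pose d : R := t%:R / mu.
pose y (v : extremal_graph n t) : R :=
  match v with inl _ => 1 | inr (inl _) => b | inr (inr _) => d end.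
exists y; first by exists (inl (Ordinal t0)); rewrite oner_eq0.
case=> [i|[i|i]]; rewrite big_sumType /= big_sumType /= !sumr_const.
- have -> : #|[pred j : 'I_t | complete_adj j i]| = t.-1 by rewrite cardC1 card_ord.
  rewrite -[X in X + _]mulr_natl -[b *+ _]mulr_natl -[d *+ _]mulr_natl.
  rewrite card_ord card_prod !card_ord muln1 -subn1 natrB // -[in RHS]muE /b /d.
  by field; rewrite D0 gt_eqF.
- have -> : #|[pred j : 'I_M | complete_adj j i]| = M.-1 by rewrite cardC1 card_ord.
  have M0 : (0 < M)%N by exact: leq_ltn_trans (leq0n i) (ltn_ord i).
  rewrite (eq_card0 (A := [pred _ | false])) // addr0 -[b *+ _]mulr_natl.
  rewrite card_ord -subn1 natrB // /b.
  by field.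
- rewrite (eq_card0 (A := [pred _ | false])) // add0r [X in _ + d *+ X]eq_card0; last first.
    by case: i => i1 i2 [j1 j2]; rewrite (ord1 i2) (ord1 j2) /in_mem /= complete_adj_irrefl andbF.
  by rewrite addr0 card_ord /d; field; rewrite gt_eqF.
Qed.

(** * Connectivity, the structure in the tight case, and the conclusion *)

Lemma connected_off_classes (G : sgraph) (T : finType) (c : G -> T) (S : {set G}) :
  (forall u v, u \notin S -> v \notin S -> adj u v -> c u = c v) ->
  connected_off S -> (#|c @: ~: S| <= 1)%N.
Proof.
move=> cadj conn; apply/card_le1_eqP => _ _ /imsetP[u uS ->] /imsetP[v vS ->].
rewrite !inE in uS vS.
have cl : closed [rel u v | [&& u \notin S, v \notin S & adj u v]]
                 [pred w | c w == c v].
  by move=> a b /= /and3P[aS bS ab]; rewrite !inE (cadj a b).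
have := closed_connect cl (conn u v uS vS).
by rewrite !inE eqxx => /eqP.
Qed.

Lemma extremal_graph_of_classes (G : sgraph) (T : finType) (c : G -> T)
    (S : {set G}) (n : nat) :
  #|G| = n -> (0 < #|S|)%N -> (2 * #|S| + 2 < n)%N ->
  (forall u v, u \notin S -> v \notin S -> adj u v -> c u = c v) ->
  (forall u v, u \in S -> u != v -> adj u v) ->
  (forall u v, u \notin S -> v \notin S -> u != v -> c u = c v -> adj u v) ->
  #|c @: ~: S| = #|S|.+2 ->
  (forall C, C \in c @: (~: S) ->
     #|[set u in ~: S | c u == C]| = 1%N \/
     #|[set u in ~: S | c u == C]| = (n - 2 * #|S| - 1)%N) ->
  sgraph_iso G (extremal_graph n #|S|).
Proof.
move=> order_G S0 Sn cadj Sadj Cadj cardCE fibE.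
pose fib C := #|[set u in ~: S | c u == C]|.
have fib_sum : (\sum_(C in c @: ~: S) fib C = #|~: S|)%N.
  rewrite -sum1_card (partition_big_imset c); apply: eq_bigr => C _.
  by rewrite /fib -sum1_card; apply: eq_bigl => u; rewrite inE.
have cardCS := cardsC S.
(* Singletons alone would give [n = 2 * #|S| + 2]. *)
have [C CC fibC] : exists2 C, C \in c @: ~: S & fib C = (n - 2 * #|S| - 1)%N.
  apply: contrapT => H.
  have : (\sum_(C in c @: ~: S) fib C = \sum_(C in c @: ~: S) 1)%N.
    by apply: eq_bigr => C CC; case: (fibE C CC) => // E; case: H; exists C.
  by rewrite fib_sum sum1_card; lia.
(* The other [#|S| + 1] classes have total size [#|S| + 1]. *)
have fib1 D : D \in c @: (~: S) -> D != C -> (fib D <= 1)%N.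
  move=> DC DnC; apply: (@leq_part _ ((c @: ~: S) :\ C) fib 1 #|S|).
  - move=> E; rewrite inE => /andP[_ /imsetP[u uS ->]].
    by apply/card_gt0P; exists u; rewrite inE uS eqxx.
  - by have := cardsD1 C (c @: ~: S); rewrite CC; lia.
  - have := fib_sum; rewrite (big_setD1 C) //= fibC; lia.
  - by rewrite !inE DnC.
apply: (@extremal_graph_iso _ _ _ S [set u in ~: S | c u == C]) => //.
- by lia.
- by rewrite disjoints_subset; apply/subsetP => u uS; rewrite !inE uS.
move=> u v; have [->|uv] := eqVneq u v; first by rewrite adj_irrefl.
case: (boolP (u \in S)) => uS /=; first exact: Sadj.
case: (boolP (v \in S)) => vS /=; first by rewrite adj_sym Sadj // eq_sym.
rewrite !inE uS vS /=; apply/idP/andP => [/(cadj _ _ uS vS) cuv|[/eqP cu /eqP cv]]; last first.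
  by apply: Cadj; rewrite ?cu ?cv.
suff cuC : c u = C by rewrite -cuv cuC.
apply/eqP/negPn/negP => cuC.
have := fib1 (c u) (imset_f c _) cuC; rewrite in_setC uS => /(_ isT) /card_le1_eqP.
move=> /(_ u v); rewrite !inE uS vS cuv eqxx => /(_ isT isT) E.
by rewrite E eqxx in uv.
Qed.

Theorem theorem1p2 (R : realType) (t k n : nat) (G : sgraph)
    (t_gt0 : (0 < t)%N) (k_gt0 : (0 < k)%N) (k_odd : k = 1 %[mod 2])
    (order_G : #|G| = n) (G_conn : vertex_connected t G)
    (n_even : ~~ odd n) (n_ge : (5 * t + 3 <= n)%N)
    (rho_ge : spectral_radius R (extremal_graph n t) <= spectral_radius R G) :
  ~ sgraph_iso G (extremal_graph n t) -> has_perfect_k_matching G k.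
Proof.
move=> notiso; apply: contrapT => nokm.
have evG : ~~ odd #|G| by rewrite order_G.
have npm f : ~ perfect_matching (@adj G) f.
  by move=> /(perfect_k_matching_of_perfect k).
have [S [c [cadj cardC]]] := tutte_classes (@adj_sym G) (@adj_irrefl G) evG npm.
have [_ conn] := G_conn.
(* Deleting fewer than [t] vertices would leave a single class, against at least [#|S| + 2]. *)
have tS : (t <= #|S|)%N.
  by rewrite leqNgt; apply/negP => /conn /(connected_off_classes cadj); lia.
have Sn : (2 * #|S| + 2 <= n)%N.
  by have := leq_imset_card c (~: S); have := cardsC S; lia.
have S0 : (0 < #|S|)%N := leq_trans t_gt0 tS.
have tn2 : (2 * t + 2 < n)%N by lia.
have G0 : (0 < #|G|)%N by lia.
have cardG : #|G| = (n - 2 * #|S| - 1 + 2 * #|S| + 1)%N by lia.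
have ME a : (2 * a + 2 <= n)%N -> (n - 2 * a - 1)%:R = n%:R - 2 * a%:R - 1 :> R.
  by move=> an; rewrite -subnDA natrB ?natrD ?natrM; [ring|lia].
have conn0 : connected_off (set0 : {set G}) by apply: conn; rewrite cards0.
have t1 : 1 <= t%:R :> R by rewrite ler1n.
have ts : t%:R <= #|S|%:R :> R by rewrite ler_nat.
have sn : 2 * #|S|%:R + 2 <= n%:R :> R by rewrite -natrM -natrD ler_nat.
have tn : 5 * t%:R + 3 <= n%:R :> R by rewrite -natrM -natrD ler_nat.
have [mu mun mu_root] := quotient_char_root t1 tn.
have bounds (nR tR sR : R) : 1 <= tR -> tR <= sR -> 5 * tR + 3 <= nR ->
    nR - tR - 2 <= mu ->
    [/\ 0 < mu, nR - 2 * sR - 1 < mu + 1 & 0 < mu - (nR - 2 * sR - 2)].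
  by clear => *; split; lra.
have [mu0 mut mut'] := bounds _ _ _ t1 (lexx _) tn mun.
have [_ mus mus'] := bounds _ _ _ t1 ts tn mun.
have mu_le : mu <= spectral_radius R G.
  apply: le_trans rho_ge.
  have [|_ ->//] := @spectral_radiusP R (extremal_graph n t).
    by apply/card_gt0P; exists (inl (Ordinal t_gt0)).
  apply: extremal_graph_eigenvalue => //; rewrite (ME _ (ltnW tn2)) //.
  have := quotient_charE mu0 mut'; rewrite mu_root mul0r -[t.+1%:R]natr1.
  by move/eqP; rewrite subr_eq0 => /eqP.
have [rho_eig _] := spectral_radiusP R G0.
have sE := quotient_charE mu0 mus'.
have tight := separated_classes_tight conn0 cadj cardC S0 cardG mu0 _ _ rho_eig mu_le.
rewrite ME // -[#|S|.+1%:R]natr1 in tight.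
(* For [t < #|S|] the inequality on [S] is strict, against tightness; for [t = #|S|] it is an
   equality and the structure of [G] follows. *)
have [tS_eq|tS_neq] := eqVneq t #|S|; last first.
  have ts_lt : t%:R < #|S|%:R :> R by rewrite ltr_nat ltn_neqAle tS_neq.
  have char0 := quotient_char_gt0 t1 ts_lt sn tn mun mu_root.
  have := divr_gt0 char0 (mulr_gt0 mu0 mus'); rewrite -sE subr_gt0 => gap.
  have [//||le_mu _ _ _ _] := tight; first exact: ltW.
  by have := lt_le_trans gap le_mu; rewrite ltxx.
have [//||_ Sadj Cadj cardCE fibE] := tight.
  by rewrite -subr_ge0 sE -tS_eq mu_root mul0r.
apply: notiso; rewrite tS_eq in tn2 *; exact: extremal_graph_of_classes fibE.
Qed.
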